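(* Consider the interface problem for the massless Dirac equation on the two half-lines: find four functions $\Psi_1^{(1)},\Psi_2^{(1)}$ (defined for $x<0$, $t>0$) and $\Psi_1^{(2)},\Psi_2^{(2)}$ (defined for $x>0$, $t>0$) such that (i) for $j=1$ (with $x<0$) and $j=2$ (with $x>0$), and all $t>0$, $$i\,\partial_t\Psi_1^{(j)}(x,t)=-i\,\partial_x\Psi_1^{(j)}(x,t),\qquad i\,\partial_t\Psi_2^{(j)}(x,t)=i\,\partial_x\Psi_2^{(j)}(x,t);$$ (ii) for $l=1,2$: $\Psi_l^{(1)}(x,0)=\Psi_{l,0}^{(1)}(x)$ for $x<0$ and $\Psi_l^{(2)}(x,0)=\Psi_{l,0}^{(2)}(x)$ for $x>0$, where $\Psi_{l,0}^{(1)},\Psi_{l,0}^{(2)}$ are given initial data; (iii) for $l=1,2$ and all $t\ge 0$: $\Psi_l^{(1)}(x,t)$, $\partial_x\Psi_l^{(1)}(x,t)$ and $\partial_t\Psi_l^{(1)}(x,t)$ tend to $0$ as $x\to-\infty$, and $\Psi_l^{(2)}(x,t)$, $\partial_x\Psi_l^{(2)}(x,t)$ and $\partial_t\Psi_l^{(2)}(x,t)$ tend to $0$ as $x\to+\infty$; (iv) for all $t>0$: $\Psi_1^{(1)}(0,t)=\Psi_1^{(2)}(0,t)$ and $\Psi_2^{(1)}(0,t)=\Psi_2^{(2)}(0,t)$. The solution of this problem is given, for $x<0$ and $t>0$, by $$\Psi_1^{(1)}(x,t)=\Psi_{1,0}^{(1)}(x-t),\qquad \Psi_2^{(1)}(x,t)=\begin{cases}-\Psi_{2,0}^{(1)}(x+t),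 & -x\ge t,\\ \Psi_2^{(1)}(0,x+t), & -x<t,\end{cases}$$ and, for $x>0$ and $t>0$, by $$\Psi_1^{(2)}(x,t)=\begin{cases}\Psi_{1,0}^{(2)}(x-t), & x\ge t,\\ \Psi_1^{(1)}(0,t-x), & x<t,\end{cases}\qquad \Psi_2^{(2)}(x,t)=\Psi_{2,0}^{(2)}(x+t).$$
   Context: The superscript $(1)$ refers to the left half-line $x<0$ and the superscript $(2)$ to the right half-line $x>0$; the subscript $l=1,2$ labels the two components of the Dirac system. $\Psi_l^{(j)}(0,t)$ denotes the value of $\Psi_l^{(j)}$ at the interface $x=0$ at time $t$. All boundary and initial conditions are assumed to be compatible wherever they meet; in particular, when $x=t$, $\Psi_{1,0}^{(j)}(x-t)=\Psi_1^{(j)}(0,t-x)$ for $j=1,2$.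
   Formalization: The minus sign in the formula for Ψ_2^{(1)} when −x ≥ t is corrected to plus, Ψ_2^{(1)}(x,t)=Ψ_{2,0}^{(1)}(x+t), since the printed sign contradicts initial condition (ii) for nonzero data; solutions are read as classical, with existence for C^1-compatible data. *)

(* Defs.v *)
From Stdlib Require Import Reals.
From Coquelicot Require Import Coquelicot.

Local Open Scope R_scope.

Inductive side := Left | Right.
Inductive comp := One | Two.

Definition half_line (j : side) (x : R) : Prop :=
  match j with Left => x < 0 | Right => 0 < x end.

Definition closed_half_line (j : side) (x : R) : Prop :=
  match j with Left => x <= 0 | Right => 0 <= x end.

Definition far_end (j : side) : Rbar :=
  match j with Left => m_infty | Right => p_infty end.

(* For D a neighbourhood of x this is [is_derive f x l], with C viewed as a
   real normed space; at an end point of D it is the one-sided derivative. *)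
Definition is_derive_within (D : R -> Prop) (f : R -> C) (x : R) (l : C) : Prop :=
  filterdiff (K := R_AbsRing) (U := R_NormedModule) (V := C_R_NormedModule)
    f (within D (locally x)) (fun h : R => scal h l).

Definition continuous_within {T : UniformSpace} (D : T -> Prop) (f : T -> C) : Prop :=
  forall p : T, D p -> filterlim f (within D (locally p)) (locally (f p)).

Definition vanishes_at (b : Rbar) (f : R -> C) : Prop :=
  filterlim f (Rbar_locally b) (locally (RtoC 0)).

(* [Psi j l x t] is the l-th component on side j, and [Psi0 j l] its initial
   datum.  All functions are total; only their values on the closed half-line
   and at times t >= 0 matter. *)
Definition field := side -> comp -> R -> R -> C.
Definition datum := side -> comp -> R -> C.

(* Classical solution with partial derivatives Px and Pt: continuous up to the
   interface and to t = 0 (so that interface, initial and corner values are the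
   limits from the open quadrant) and C^1 for x <> 0, t >= 0, the time derivative
   at t = 0 being one-sided. *)
Record is_solution_with (Psi0 : datum) (Psi Px Pt : field) : Prop := {
  sol_continuous : forall j l,
    continuous_within (fun p : R * R => closed_half_line j (fst p) /\ 0 <= snd p)
      (fun p => Psi j l (fst p) (snd p));
  sol_derive_x : forall j l x t, half_line j x -> 0 <= t ->
    is_derive_within (half_line j) (fun y => Psi j l y t) x (Px j l x t);
  sol_derive_t : forall j l x t, half_line j x -> 0 <= t ->
    is_derive_within (fun s => 0 <= s) (fun s => Psi j l x s) t (Pt j l x t);
  sol_continuous_x : forall j l,
    continuous_within (fun p : R * R => half_line j (fst p) /\ 0 <= snd p)
      (fun p => Px j l (fst p) (snd p));
  sol_continuous_t : forall j l,
    continuous_within (fun p : R * R => half_line j (fst p) /\ 0 <= snd p)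
      (fun p => Pt j l (fst p) (snd p));
  sol_dirac1 : forall j x t, half_line j x -> 0 < t ->
    (Ci * Pt j One x t)%C = (- Ci * Px j One x t)%C;
  sol_dirac2 : forall j x t, half_line j x -> 0 < t ->
    (Ci * Pt j Two x t)%C = (Ci * Px j Two x t)%C;
  sol_initial : forall j l x, half_line j x -> Psi j l x 0 = Psi0 j l x;
  (* compatibility of initial datum and interface value at the corner *)
  sol_corner : forall j l, Psi j l 0 0 = Psi0 j l 0;
  sol_decay : forall j l t, 0 <= t ->
    vanishes_at (far_end j) (fun x => Psi j l x t) /\
    vanishes_at (far_end j) (fun x => Px j l x t) /\
    vanishes_at (far_end j) (fun x => Pt j l x t);
  sol_interface : forall l t, 0 < t -> Psi Left l 0 t = Psi Right l 0 t
}.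

Definition is_solution (Psi0 : datum) (Psi : field) : Prop :=
  exists Px Pt : field, is_solution_with Psi0 Psi Px Pt.

(* Data that are C^1 up to x = 0, decay with their derivatives, and are
   compatible at x = 0.  Both matching conditions at 0 are necessary for
   a classical solution: it transports the two data along the same
   characteristics across x = t (component One, right) and x = - t (component
   Two, left). *)
Definition admissible (Psi0 : datum) : Prop :=
  exists dPsi0 : datum,
    (forall j l x, closed_half_line j x ->
       is_derive_within (closed_half_line j) (Psi0 j l) x (dPsi0 j l x)) /\
    (forall j l, continuous_within (closed_half_line j) (dPsi0 j l)) /\
    (forall j l, vanishes_at (far_end j) (Psi0 j l) /\
                 vanishes_at (far_end j) (dPsi0 j l)) /\
    (forall l, Psi0 Left l 0 = Psi0 Right l 0 /\ dPsi0 Left l 0 = dPsi0 Right l 0).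

(* Main.v *)
Require Import Defs.
From Stdlib Require Import Reals Lra.
From Coquelicot Require Import Coquelicot.
Local Open Scope R_scope.

(** The equations say that component One satisfies [(d_t + d_x) Psi = 0] and
    component Two [(d_t - d_x) Psi = 0]: with [speed One = 1] and
    [speed Two = -1], the l-th component is constant along the characteristics
    [x = c + speed l * t], as long as these stay on one half-line.

    Uniqueness ([solution_transported]) traces the characteristic through
    [(x, t)] backwards in time until it meets the boundary of the quadrant.
    If it reaches the axis [t = 0], the value is that of the initial datum; if
    it first reaches the interface, the value is the interface value at that
    time, which the interface condition carries from one side to the other.
    Along the open part of the characteristic the chain rule applies, because
    continuous partial derivatives give differentiability in two variables, and
    the derivative is zero; the boundary value then follows by continuity.

    Existence: since the two data of a component match to first order at
    [x = 0], they glue to one C^1 function [u] on the whole line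
    ([is_derive_glue], [continuous_glue]), and [u (x - speed l * t)] solves the
    problem on both half-lines at once ([travelling_wave_solution]). *)

(** * Half-lines and filters *)

Lemma half_line_closed (j : side) (x : R) : half_line j x -> closed_half_line j x.
Proof. destruct j; simpl; lra. Qed.

Lemma half_line_locally (j : side) (x : R) :
  half_line j x -> locally x (half_line j).
Proof.
  destruct j; simpl; intros H.
  - exact (open_lt 0 x H).
  - exact (open_gt 0 x H).
Qed.

(** The two closed half-lines cover the line, and a half-line not containing [x]
    stays away from [x]; so local statements can be checked on the sides that
    contain [x].  At [x = 0] both sides contribute. *)
Lemma locally_by_sides (x : R) (P : R -> Prop) :
  (forall j, closed_half_line j x -> within (closed_half_line j) (locally x) P) ->
  locally x P.
Proof.
  intros H.
  assert (Hj : forall j, within (closed_half_line j) (locally x) P).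
  { intros j; destruct (Rle_dec x 0) as [Hx|Hx]; destruct j;
      try (apply H; simpl; lra).
    - destruct (Req_dec x 0) as [H0|H0]; [apply H; simpl; lra|].
      apply filter_imp with (2 := half_line_locally Left x ltac:(simpl; lra)).
      simpl; intros; lra.
    - apply filter_imp with (2 := half_line_locally Right x ltac:(simpl; lra)).
      simpl; intros; lra. }
  unfold within in Hj.
  apply filter_imp with (2 := filter_and _ _ (Hj Left) (Hj Right)).
  simpl; intros y [HL HR]; destruct (Rle_dec y 0); [apply HL | apply HR]; lra.
Qed.

(** * Derivatives relative to a set *)

Lemma is_derive_within_interior (D : R -> Prop) (f : R -> C) (x : R) (l : C) :
  locally x D -> is_derive_within D f x l ->
  is_derive (V := C_R_NormedModule) f x l.
Proof.
  intros HD [Hl Hf]; split; [exact Hl|].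
  intros y Hy eps.
  assert (Hw : is_filter_lim (within D (locally x)) y).
  { intros P HP; apply filter_imp with (2 := Hy P HP); intros z Hz _; exact Hz. }
  apply filter_imp with (2 := filter_and _ _ HD (Hf y Hw eps)).
  intros z [Hz1 Hz2]; exact (Hz2 Hz1).
Qed.

Lemma is_derive_is_derive_within (D : R -> Prop) (f : R -> C) (x : R) (l : C) :
  D x -> is_derive (V := C_R_NormedModule) f x l -> is_derive_within D f x l.
Proof.
  intros Dx [Hl Hf]; split; [exact Hl|].
  intros y Hy eps.
  assert (Hxy : y = x).
  { (* If [y <> x], the ball of radius [|y - x|] about [y] misses [x]. *)
    destruct (Req_dec y x) as [H|H]; [exact H|exfalso].
    assert (Hd : 0 < Rabs (y - x)) by (apply Rabs_pos_lt; lra).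
    assert (Hw := Hy _ (locally_ball y (mkposreal _ Hd))).
    assert (Hx := locally_singleton _ _ Hw Dx).
    change (Rabs (x - y) < Rabs (y - x)) in Hx.
    rewrite Rabs_minus_sym in Hx; lra. }
  subst y.
  apply filter_imp with (2 := Hf x (fun P HP => HP) eps).
  intros z Hz _; exact Hz.
Qed.

Lemma is_derive_fst (f : R -> C) (x : R) (l : C) :
  is_derive (V := C_R_NormedModule) f x l ->
  is_derive (fun y => fst (f y)) x (fst l).
Proof.
  intros H.
  exact (filterdiff_comp' (U := R_NormedModule) (V := C_R_NormedModule)
    (W := R_NormedModule) f (fun z : C => fst z) x _ (fun z : C => fst z) H
    (filterdiff_linear _ (is_linear_fst (U := R_NormedModule) (V := R_NormedModule)))).
Qed.

Lemma is_derive_snd (f : R -> C) (x : R) (l : C) :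
  is_derive (V := C_R_NormedModule) f x l ->
  is_derive (fun y => snd (f y)) x (snd l).
Proof.
  intros H.
  exact (filterdiff_comp' (U := R_NormedModule) (V := C_R_NormedModule)
    (W := R_NormedModule) f (fun z : C => snd z) x _ (fun z : C => snd z) H
    (filterdiff_linear _ (is_linear_snd (U := R_NormedModule) (V := R_NormedModule)))).
Qed.

(** * Constancy along characteristics *)

Definition speed (l : Defs.comp) : R := match l with One => 1 | Two => -1 end.

(** Continuity of the partial derivative [fx] makes [f] differentiable in both
    variables jointly, which is what the chain rule requires. *)
Lemma is_derive_along_line (f fx : R -> R -> R) (dt c d s : R) :
  locally (c + d * s, s) (fun u : R * R =>
    is_derive (fun z => f z (snd u)) (fst u) (fx (fst u) (snd u))) ->
  is_derive (fun z => f (c + d * s) z) s dt ->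
  continuous (fun u : R * R => fx (fst u) (snd u)) (c + d * s, s) ->
  is_derive (fun z => f (c + d * z) z) s (dt + d * fx (c + d * s) s).
Proof.
  intros Hx Ht Hc.
  assert (H := is_derive_filterdiff f (c + d * s) s fx dt Hx Ht Hc).
  assert (Hline : is_derive (fun z => c + d * z) s d)
    by (auto_derive; [exact I | ring]).
  assert (Hid : is_derive (fun z : R => z) s 1) by apply (is_derive_id s).
  assert (G := filterdiff_comp'_2 (U := R_NormedModule) (V := R_NormedModule)
    (fun z => c + d * z) (fun z => z) f s _ _
    (fun h k => plus (scal h (fx (c + d * s) s)) (scal k dt)) Hline Hid H).
  apply filterdiff_ext_lin with (1 := G).
  intros y; unfold scal, plus; simpl; unfold mult; simpl; ring.
Qed.

(** [ft + d * fx] is the derivative of [f] along the line [x = c + d * t]. *)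
Lemma transport_constant (D : R -> Prop) (d : R) (f fx ft : R -> R -> R) :
  open D ->
  (forall x t, D x -> 0 < t -> is_derive (fun y => f y t) x (fx x t)) ->
  (forall x t, D x -> 0 < t -> is_derive (fun s => f x s) t (ft x t)) ->
  (forall x t, D x -> 0 < t ->
     continuous (fun p : R * R => fx (fst p) (snd p)) (x, t)) ->
  (forall x t, D x -> 0 < t -> ft x t + d * fx x t = 0) ->
  forall c a b, 0 < a -> a < b ->
    (forall s, a <= s <= b -> D (c + d * s)) ->
    f (c + d * a) a = f (c + d * b) b.
Proof.
  intros HD Hx Ht Hc Heq c a b Ha Hab Hline.
  apply (eq_is_derive (fun s => f (c + d * s) s)); [|exact Hab].
  intros s Hs.
  assert (Ds := Hline s Hs).
  assert (s_pos : 0 < s) by lra.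
  replace (@zero R_NormedModule) with (ft (c + d * s) s + d * fx (c + d * s) s)
    by (rewrite Heq; auto).
  apply is_derive_along_line; auto.
  apply filter_imp with (P := fun u : R * R => D (fst u) /\ 0 < snd u).
  { intros u [Hu1 Hu2]; auto. }
  apply filter_and.
  - apply (continuous_fst (U := R_UniformSpace) (V := R_UniformSpace)
      (c + d * s) s D); apply HD; exact Ds.
  - apply (continuous_snd (U := R_UniformSpace) (V := R_UniformSpace)
      (c + d * s) s (fun t => 0 < t)); exact (open_gt 0 s s_pos).
Qed.

Section Solution.

Variables (Psi0 : datum) (Psi Px Pt : field).
Hypothesis sol : is_solution_with Psi0 Psi Px Pt.

Lemma solution_transport_equation (j : side) (l : Defs.comp) (x t : R) :
  half_line j x -> 0 < t ->
  fst (Pt j l x t) + speed l * fst (Px j l x t) = 0 /\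
  snd (Pt j l x t) + speed l * snd (Px j l x t) = 0.
Proof.
  intros Hx Ht; destruct l; simpl;
    [assert (H := sol_dirac1 _ _ _ _ sol j x t Hx Ht)
    |assert (H := sol_dirac2 _ _ _ _ sol j x t Hx Ht)];
    assert (H1 := f_equal fst H); assert (H2 := f_equal snd H);
    simpl in H1, H2; lra.
Qed.

Lemma solution_derive_x (j : side) (l : Defs.comp) (x t : R) :
  half_line j x -> 0 < t ->
  is_derive (V := C_R_NormedModule) (fun y => Psi j l y t) x (Px j l x t).
Proof.
  intros Hx Ht; apply is_derive_within_interior with (half_line j).
  - exact (half_line_locally j x Hx).
  - apply (sol_derive_x _ _ _ _ sol); [exact Hx | lra].
Qed.

Lemma solution_derive_t (j : side) (l : Defs.comp) (x t : R) :
  half_line j x -> 0 < t ->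
  is_derive (V := C_R_NormedModule) (fun s => Psi j l x s) t (Pt j l x t).
Proof.
  intros Hx Ht; apply is_derive_within_interior with (fun s => 0 <= s).
  - apply filter_imp with (2 := open_gt 0 t Ht); intros; lra.
  - apply (sol_derive_t _ _ _ _ sol); [exact Hx | lra].
Qed.

Lemma solution_continuous_x (j : side) (l : Defs.comp) (x t : R) :
  half_line j x -> 0 < t ->
  continuous (fun p : R * R => Px j l (fst p) (snd p)) (x, t).
Proof.
  intros Hx Ht P HP.
  assert (H := sol_continuous_x _ _ _ _ sol j l (x, t)
                 (conj Hx (Rlt_le _ _ Ht)) P HP).
  unfold filtermap, within in H; simpl in H.
  assert (H1 : locally (x, t) (fun p : R * R => half_line j (fst p)))
    by exact (continuous_fst (U := R_UniformSpace) (V := R_UniformSpace) x t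
                _ (half_line_locally j x Hx)).
  assert (H2 : locally (x, t) (fun p : R * R => 0 < snd p))
    by exact (continuous_snd (U := R_UniformSpace) (V := R_UniformSpace) x t
                _ (open_gt 0 t Ht)).
  apply filter_imp with (2 := filter_and _ _ H (filter_and _ _ H1 H2)).
  intros p [Hp [Hp1 Hp2]]; apply Hp; split; [exact Hp1 | lra].
Qed.

Lemma solution_constant_inside (j : side) (l : Defs.comp) (c a b : R) :
  0 < a -> a < b ->
  (forall s, a <= s <= b -> half_line j (c + speed l * s)) ->
  Psi j l (c + speed l * a) a = Psi j l (c + speed l * b) b.
Proof.
  intros Ha Hab Hline.
  assert (HD : open (half_line j)) by exact (half_line_locally j).
  apply injective_projections.
  - apply (transport_constant (half_line j) (speed l)
      (fun x t => fst (Psi j l x t)) (fun x t => fst (Px j l x t))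
      (fun x t => fst (Pt j l x t))); auto; intros x t Hx Ht.
    + exact (is_derive_fst _ _ _ (solution_derive_x j l x t Hx Ht)).
    + exact (is_derive_fst _ _ _ (solution_derive_t j l x t Hx Ht)).
    + apply (continuous_comp (fun p : R * R => Px j l (fst p) (snd p)) fst).
      * exact (solution_continuous_x j l x t Hx Ht).
      * destruct (Px j l (fst (x, t)) (snd (x, t))); apply continuous_fst.
    + apply solution_transport_equation; assumption.
  - apply (transport_constant (half_line j) (speed l)
      (fun x t => snd (Psi j l x t)) (fun x t => snd (Px j l x t))
      (fun x t => snd (Pt j l x t))); auto; intros x t Hx Ht.
    + exact (is_derive_snd _ _ _ (solution_derive_x j l x t Hx Ht)).
    + exact (is_derive_snd _ _ _ (solution_derive_t j l x t Hx Ht)).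
    + apply (continuous_comp (fun p : R * R => Px j l (fst p) (snd p)) snd).
      * exact (solution_continuous_x j l x t Hx Ht).
      * destruct (Px j l (fst (x, t)) (snd (x, t))); apply continuous_snd.
    + apply solution_transport_equation; assumption.
Qed.

(** The starting point may lie on the interface, at time 0, or in the corner,
    where no two-sided derivative is available: the value there is the
    limit of the constant value along the open part of the characteristic. *)
Lemma solution_transported (j : side) (l : Defs.comp) (c a b : R) :
  0 <= a -> a < b ->
  closed_half_line j (c + speed l * a) ->
  (forall s, a < s <= b -> half_line j (c + speed l * s)) ->
  Psi j l (c + speed l * b) b = Psi j l (c + speed l * a) a.
Proof.
  intros Ha Hab Hstart Hline.
  set (g := fun s => Psi j l (c + speed l * s) s).
  assert (Hnear : at_right a (fun s => a < s < b)).
  { apply filter_imp with (2 := open_lt b a Hab); intros; lra. }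
  assert (Hlim : filterlim g (at_right a) (locally (g a))).
  { apply (filterlim_comp R (R * R) C (fun s => (c + speed l * s, s))
      (fun p => Psi j l (fst p) (snd p)) (at_right a)
      (within (fun p => closed_half_line j (fst p) /\ 0 <= snd p)
         (locally (c + speed l * a, a)))).
    - intros P HP.
      assert (Hc : continuous (fun s : R => (c + speed l * s, s)) a).
      { apply (continuous_comp_2 (U := R_UniformSpace) (V := R_UniformSpace)
          (W := R_UniformSpace) (X := prod_UniformSpace R_UniformSpace R_UniformSpace)
          (fun s => c + speed l * s) (fun s => s) (fun x s => (x, s))).
        - apply (ex_derive_continuous (V := R_NormedModule)); auto_derive; exact I.
        - apply continuous_id.
        - apply continuous_ext with (f := fun p => p); [|apply continuous_id].
          intros [y s]; reflexivity. }
      assert (HP' : at_right a (fun s : R =>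
        closed_half_line j (c + speed l * s) /\ 0 <= s -> P (c + speed l * s, s))).
      { assert (Hpull := Hc _ HP); unfold filtermap in Hpull.
        apply filter_imp with (2 := Hpull); intros s Hs _; exact Hs. }
      apply filter_imp with (2 := filter_and _ _ Hnear HP').
      intros s [Hs1 Hs2]; apply Hs2; split; [|lra].
      apply half_line_closed, Hline; lra.
    - apply (sol_continuous _ _ _ _ sol j l (c + speed l * a, a)); auto. }
  assert (Hconst : filterlim g (at_right a) (locally (g b))).
  { apply filterlim_ext_loc with (f := fun _ => g b); [|apply filterlim_const].
    apply filter_imp with (2 := Hnear); intros s Hs; symmetry.
    apply solution_constant_inside; [lra | lra |].
    intros; apply Hline; lra. }
  exact (filterlim_locally_unique (V := C_R_NormedModule) _ _ _ Hconst Hlim).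
Qed.

Lemma solution_at_start (j : side) (l : Defs.comp) (x : R) :
  closed_half_line j x -> Psi j l x 0 = Psi0 j l x.
Proof.
  intros Hx; destruct (Req_dec x 0) as [->|H0].
  - apply (sol_corner _ _ _ _ sol).
  - apply (sol_initial _ _ _ _ sol); destruct j; simpl in *; lra.
Qed.

Lemma solution_from_datum (j : side) (l : Defs.comp) (x t : R) :
  half_line j x -> 0 < t -> closed_half_line j (x - speed l * t) ->
  Psi j l x t = Psi0 j l (x - speed l * t).
Proof.
  intros Hx Ht Hstart.
  rewrite <- solution_at_start by exact Hstart.
  assert (H := solution_transported j l (x - speed l * t) 0 t (Rle_refl 0) Ht).
  replace (x - speed l * t + speed l * t) with x in H by ring.
  replace (x - speed l * t + speed l * 0) with (x - speed l * t) in H by ring.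
  apply H; [exact Hstart|].
  intros s Hs; destruct j, l; simpl in *; lra.
Qed.

(** The hypothesis on [speed l] says that the characteristics of the l-th
    component run from the interface into side [j]. *)
Lemma solution_from_interface (j : side) (l : Defs.comp) (x t : R) :
  half_line j x -> half_line j (speed l) -> 0 < t - speed l * x ->
  Psi j l x t = Psi j l 0 (t - speed l * x).
Proof.
  intros Hx Hl Ht.
  (* [speed l] is its own inverse, so the line meets [x = 0] at the time
     [t - speed l * x]. *)
  assert (Hsq : speed l * speed l = 1) by (destruct l; simpl; ring).
  assert (H := solution_transported j l (x - speed l * t) (t - speed l * x) t
                 (Rlt_le _ _ Ht)).
  replace (x - speed l * t + speed l * t) with x in H by ring.
  replace (x - speed l * t + speed l * (t - speed l * x)) with 0 in H
    by (transitivity (x - speed l * speed l * x); [rewrite Hsq|]; ring).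
  apply H; [| destruct j; simpl; lra |];
    [|intros s Hs]; destruct j, l; simpl in *; lra.
Qed.

End Solution.

(** * Gluing the data of the two sides *)

Definition glue (f : side -> R -> C) (x : R) : C :=
  if Rle_dec x 0 then f Left x else f Right x.

Section Glue.

Variable f : side -> R -> C.
Hypothesis f_match : f Left 0 = f Right 0.

Lemma glue_on_side (j : side) (x : R) : closed_half_line j x -> glue f x = f j x.
Proof.
  unfold glue; intros Hx; destruct (Rle_dec x 0) as [H|H], j; simpl in Hx; auto.
  - replace x with 0 by lra; exact f_match.
  - lra.
Qed.

Lemma continuous_glue :
  (forall j, continuous_within (closed_half_line j) (f j)) ->
  forall x, continuous (glue f) x.
Proof.
  intros Hf x P HP; apply locally_by_sides; intros j Hj.
  rewrite (glue_on_side j x Hj) in HP.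
  assert (H := Hf j x Hj P HP); unfold filtermap, within in H.
  apply filter_imp with (2 := H).
  intros y Hy Dy; rewrite (glue_on_side j y Dy); exact (Hy Dy).
Qed.

Lemma is_derive_glue (df : side -> R -> C) :
  df Left 0 = df Right 0 ->
  (forall j x, closed_half_line j x ->
     is_derive_within (closed_half_line j) (f j) x (df j x)) ->
  forall x, is_derive (V := C_R_NormedModule) (glue f) x (glue df x).
Proof.
  intros df_match Hf x.
  assert (Hdf : forall j, closed_half_line j x -> glue df x = df j x).
  { unfold glue; intros j Hj; destruct (Rle_dec x 0), j; simpl in Hj; auto.
    - replace x with 0 by lra; exact df_match.
    - lra. }
  split; [apply is_linear_scal_l|].
  intros y Hy eps.
  apply (is_filter_lim_locally_unique (K := R_AbsRing) (V := R_NormedModule))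
    in Hy; subst y.
  apply locally_by_sides; intros j Hj.
  rewrite (Hdf j Hj), (glue_on_side j x Hj).
  destruct (Hf j x Hj) as [_ H].
  assert (Hlim : is_filter_lim (within (closed_half_line j) (locally x)) x).
  { intros P HP; apply filter_imp with (2 := HP); intros z Hz _; exact Hz. }
  assert (Hdom := H x Hlim eps); unfold within in Hdom |- *.
  apply filter_imp with (2 := Hdom).
  intros y Hy Dy; rewrite (glue_on_side j y Dy); exact (Hy Dy).
Qed.

Lemma vanishes_at_glue (j : side) :
  vanishes_at (far_end j) (f j) -> vanishes_at (far_end j) (glue f).
Proof.
  apply filterlim_ext_loc.
  destruct j; exists 0; intros x Hx; symmetry;
    apply glue_on_side; simpl; lra.
Qed.

End Glue.

(** * Travelling waves *)

Lemma vanishes_at_shift (j : side) (u : R -> C) (a : R) :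
  vanishes_at (far_end j) u -> vanishes_at (far_end j) (fun x => u (x - a)).
Proof.
  intros Hu; refine (filterlim_comp _ _ _ (fun x => x - a) u _ _ _ _ Hu).
  destruct j; intros P [M HM]; exists (M + a); intros x Hx; apply HM; lra.
Qed.

Lemma vanishes_at_scal (b : Rbar) (k : R) (u : R -> C) :
  vanishes_at b u ->
  vanishes_at b (fun x => scal (V := C_R_NormedModule) k (u x)).
Proof.
  intros Hu; unfold vanishes_at.
  replace (RtoC 0) with (scal (V := C_R_NormedModule) k (RtoC 0)).
  - exact (filterlim_comp _ _ _ u _ _ _ _ Hu
      (filterlim_scal_r (V := C_R_NormedModule) k (RtoC 0))).
  - apply injective_projections; simpl; unfold scal; simpl; unfold mult; simpl; ring.
Qed.

Lemma continuous_within_of_continuous {T : UniformSpace} (D : T -> Prop) (f : T -> C) :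
  (forall p, continuous f p) -> continuous_within D f.
Proof.
  intros Hf p _ P HP.
  assert (H := Hf p P HP); unfold filtermap in H.
  apply filter_imp with (2 := H); intros q Hq _; exact Hq.
Qed.

Lemma continuous_wave (u : R -> C) (d : R) :
  (forall x, continuous u x) ->
  forall p : R * R, continuous (fun q : R * R => u (fst q - d * snd q)) p.
Proof.
  intros Hu [x t].
  apply (continuous_comp (fun q : R * R => fst q - d * snd q) u); [|apply Hu].
  apply (continuous_minus (V := R_NormedModule)).
  - apply (continuous_fst (U := R_UniformSpace) (V := R_UniformSpace)).
  - apply (continuous_scal_r (V := R_NormedModule) d (fun q : R * R => snd q)).
    apply (continuous_snd (U := R_UniformSpace) (V := R_UniformSpace)).
Qed.

(** The wave does not depend on the side, so the two traces at the interface
    coincide whatever [u] is; all regularity is inherited from [u]. *)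
Lemma travelling_wave_solution (Psi0 : datum) (u du : Defs.comp -> R -> C) :
  (forall l x, is_derive (V := C_R_NormedModule) (u l) x (du l x)) ->
  (forall l x, continuous (du l) x) ->
  (forall j l, vanishes_at (far_end j) (u l) /\ vanishes_at (far_end j) (du l)) ->
  (forall j l x, closed_half_line j x -> u l x = Psi0 j l x) ->
  is_solution_with Psi0
    (fun _ l x t => u l (x - speed l * t))
    (fun _ l x t => du l (x - speed l * t))
    (fun _ l x t => scal (V := C_R_NormedModule) (- speed l) (du l (x - speed l * t))).
Proof.
  intros Hu Hdu Hvan Hinit.
  assert (Hcont : forall l x, continuous (u l) x).
  { intros l x; apply (ex_derive_continuous (V := C_R_NormedModule)).
    exists (du l x); apply Hu. }
  split.
  - intros j l; apply continuous_within_of_continuous, continuous_wave, Hcont.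
  - intros j l x t Hx _; apply is_derive_is_derive_within; [exact Hx|].
    assert (H : is_derive (fun y => y - speed l * t) x 1)
      by (auto_derive; [exact I | ring]).
    assert (G := is_derive_comp (V := C_R_NormedModule) (u l) _ x _ _ (Hu l _) H).
    replace (du l (x - speed l * t)) with
      (scal (V := C_R_NormedModule) 1 (du l (x - speed l * t))); [exact G|].
    apply (scal_one (V := C_R_NormedModule)).
  - intros j l x t _ Ht; apply is_derive_is_derive_within; [exact Ht|].
    assert (H : is_derive (fun s => x - speed l * s) t (- speed l))
      by (auto_derive; [exact I | ring]).
    exact (is_derive_comp (V := C_R_NormedModule) (u l) _ t _ _ (Hu l _) H).
  - intros j l; apply continuous_within_of_continuous, continuous_wave, Hdu.
  - intros j l; apply continuous_within_of_continuous; intros p.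
    apply (continuous_scal_r (V := C_R_NormedModule) (- speed l)
      (fun q : R * R => du l (fst q - speed l * snd q))).
    apply continuous_wave, Hdu.
  - intros j x t _ _; apply injective_projections; simpl;
      unfold scal; simpl; unfold mult; simpl; ring.
  - intros j x t _ _; apply injective_projections; simpl;
      unfold scal; simpl; unfold mult; simpl; ring.
  - intros j l x Hx; rewrite Rmult_0_r, Rminus_0_r.
    apply Hinit, half_line_closed, Hx.
  - intros j l; rewrite Rmult_0_r, Rminus_0_r.
    apply Hinit; destruct j; simpl; lra.
  - intros j l t _; destruct (Hvan j l) as [H1 H2]; split; [|split].
    + apply vanishes_at_shift, H1.
    + apply vanishes_at_shift, H2.
    + apply vanishes_at_scal, vanishes_at_shift, H2.
  - reflexivity.
Qed.

Lemma admissible_solvable (Psi0 : datum) :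
  admissible Psi0 -> exists Psi : field, is_solution Psi0 Psi.
Proof.
  intros [dPsi0 [Hd [Hc [Hvan Hmatch]]]].
  eexists; eexists; eexists.
  apply (travelling_wave_solution Psi0
    (fun l => glue (fun j => Psi0 j l)) (fun l => glue (fun j => dPsi0 j l))).
  - intros l; apply is_derive_glue; try apply Hmatch.
    intros j x Hx; apply Hd, Hx.
  - intros l; apply continuous_glue; [apply Hmatch | intros j; apply Hc].
  - intros j l; split.
    + apply (vanishes_at_glue (fun j => Psi0 j l)); [apply Hmatch | apply Hvan].
    + apply (vanishes_at_glue (fun j => dPsi0 j l)); [apply Hmatch | apply Hvan].
  - intros j l x Hx; apply (glue_on_side (fun j => Psi0 j l)); [apply Hmatch | exact Hx].
Qed.

(** * The solution formula *)

Theorem proposition1 (Psi0 : datum) :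
  (admissible Psi0 -> exists Psi : field, is_solution Psi0 Psi) /\
  (forall Psi : field, is_solution Psi0 Psi ->
     (forall x t : R, x < 0 -> 0 < t ->
        Psi Left One x t = Psi0 Left One (x - t) /\
        (t <= - x -> Psi Left Two x t = Psi0 Left Two (x + t)) /\
        (- x < t -> Psi Left Two x t = Psi Left Two 0 (x + t))) /\
     (forall x t : R, 0 < x -> 0 < t ->
        (t <= x -> Psi Right One x t = Psi0 Right One (x - t)) /\
        (x < t -> Psi Right One x t = Psi Left One 0 (t - x)) /\
        Psi Right Two x t = Psi0 Right Two (x + t))).
Proof.
  split; [apply admissible_solvable|].
  intros Psi [Px [Pt sol]].
  assert (HD := solution_from_datum _ _ _ _ sol).
  assert (HI := solution_from_interface _ _ _ _ sol).
  split; intros x t Hx Ht; repeat split; try intros Hxt.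
  - replace (x - t) with (x - speed One * t) by (simpl; ring).
    apply HD; simpl; lra.
  - replace (x + t) with (x - speed Two * t) by (simpl; ring).
    apply HD; simpl; lra.
  - replace (x + t) with (t - speed Two * x) by (simpl; ring).
    apply HI; simpl; lra.
  - replace (x - t) with (x - speed One * t) by (simpl; ring).
    apply HD; simpl; lra.
  - rewrite (sol_interface _ _ _ _ sol) by lra.
    replace (t - x) with (t - speed One * x) by (simpl; ring).
    apply HI; simpl; lra.
  - replace (x + t) with (x - speed Two * t) by (simpl; ring).
    apply HD; simpl; lra.
Qed.
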